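(* Consider an $s$-stage IMEX-RK scheme of type CK that is GSA and ARS, with $c_i=\tilde c_i$ for all $i$, written in Shu-Osher form, for $i=1,\dots,s$: $$f^{(i)}=\Big(1-\sum_{j=2}^{i-1}B_{i(j-1)}\Big)\mathcal S_{i,0}[f^n]+\sum_{j=2}^{i-1}B_{i(j-1)}\mathcal S_{i,j}[f^{(j)}]+\frac{\Delta t}{\varepsilon}\tilde{\hat a}_{(i-1)(i-1)}Q_P(f^{(i)})+\frac{\Delta t}{\varepsilon}\sum_{j=2}^{i-1}D_{i(j-1)}\mathcal S_{i,j}[G_P(f^{(j)})]+\frac{\Delta t}{\varepsilon}d_i\,\mathcal S_{i,0}[G_P(f^n)],$$ with $f^{n+1}=f^{(s)}$. Let $f$ be the exact solution of the Boltzmann equation, with $f^n(x,v)=f(n\Delta t,x,v)$. Then a sufficient condition for $$f^{n+1}(x,v)-f((n+1)\Delta t,x,v)=O\Big(\frac{\Delta t^2}{\varepsilon^2}\Big)$$ is $g_s=h_s=1$, where $g_i,h_i$ are defined recursively for $i=1,\dots,s$ by $$\begin{cases} g_i=\sum_{j=2}^{i-1}B_{i(j-1)}g_j+\tilde{\hat a}_{(i-1)(i-1)}, & g_1=0,\\[4pt] h_i=\sum_{j=2}^{i-1}\big(B_{i(j-1)}h_j+D_{i(j-1)}\big)+d_i, & h_1=0.\end{cases}$$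
   Context: Boltzmann equation: $\partial_t f+v\,\partial_x f=\frac1\varepsilon Q(f)$ with constant $\varepsilon>0$, one-dimensional $x$, velocity in $\mathbb R^{d_v}$ (in shifts $v$ is the first velocity component), $Q(f)(v)=\int_{\mathbb R^{d_v}}\int_{\mathbb S^{d_v-1}}\mathcal B(|v-v_*|,\sigma)[f(v')f(v'_* )-f(v)f(v_* )]\,d\sigma\,dv_*$ with $v'=\frac{v+v_*}2+\frac{|v-v_*|}2\sigma$, $v'_*=\frac{v+v_*}2-\frac{|v-v_*|}2\sigma$. $\mathcal M[f]=\frac{\rho}{(2\pi T)^{d_v/2}}\exp(-\frac{|v-u|^2}{2T})$ is the Maxwellian with the same moments $\int f(1,v,|v|^2)^\top dv$ as $f$. $Q_P(f)=\beta(f)(\mathcal M[f]-f)$ with $\beta(f)>0$ the penalization parameter, $G_P(f)=Q(f)-Q_P(f)$. All functions and operators are taken smooth enough for Taylor expansion. $\mathcal S_{i,j}[f](x,v)=f(x-(c_i-c_j)v\Delta t,v)$ with $c_0=0$. Butcher tableaux: $A=(a_{ij})$ (explicit, $a_{ij}=0$ for $j\ge i$) and $\tilde A=(\tilde a_{ij})$ (implicit, $\tilde a_{ij}=0$ for $j>i$), both $s\times s$; $c_i=\sum_ja_{ij}$, $\tilde c_i=\sum_j\tilde a_{ij}$. Type CK and ARS: $A=\begin{pmatrix}0&0\\ a&\hat A\end{pmatrix}$, $\tilde A=\begin{pmatrix}0&0\\ 0&\tilde{\hat A}\end{pmatrix}$, with $a=(a_1,\dots,a_{s-1})^\top$, $\hat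 A=(\hat a_{ij})$, $\tilde{\hat A}=(\tilde{\hat a}_{ij})\in\mathbb R^{(s-1)\times(s-1)}$ invertible, and first implicit weight $\tilde b_1=0$. GSA: last rows of $A,\tilde A$ equal the weights $b,\tilde b$, so $f^{n+1}=f^{(s)}$. For a matrix $C$, $C_{(k)}$ is its leading $k\times k$ block and $\bar C_k=(c_{k1},\dots,c_{k(k-1)})$; for a vector $w$, $w_{(k)}$ is the vector of its first $k$ entries. Then $$B_i=\bar{\tilde{\hat A}}_{i-1}\big(\tilde{\hat A}_{(i-2)}\big)^{-1},\qquad D_i=\bar{\hat A}_{i-1}-\bar{\tilde{\hat A}}_{i-1}\big(\tilde{\hat A}_{(i-2)}\big)^{-1}\hat A_{(i-2)},\qquad d_i=a_{i-1}-B_i\,a_{(i-2)},$$ where $B_i,D_i$ are row vectors with $i-2$ entries, whose $(j-1)$-th entries are $B_{i(j-1)},D_{i(j-1)}$, $2\le j\le i-1$. All quantities with non-positive subscripts, and empty sums, are zero. *)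

(* Defs.v *)
From HB Require Import structures.
From mathcomp Require Import all_boot all_order all_algebra.
From mathcomp Require Import all_classical all_reals all_analysis.

Set Implicit Arguments.
Unset Strict Implicit.
Unset Printing Implicit Defensive.

Import Order.TTheory GRing.Theory Num.Theory.
Import numFieldNormedType.Exports.

Local Open Scope classical_set_scope.
Local Open Scope ring_scope.

(* The library has no n-dimensional Lebesgue measure: it is built on
   [n.-tuple R] (with the product sigma-algebra) as the image of the product
   measure [lebesgue_measure \x leb_tuple n] by [(x, t) |-> x :: t]. *)
Section LebesgueTuple.
Variable R : realType.
Local Notation mR := (measurableTypeR R).
Local Notation cons_pair n :=
  (fun z : mR * n.-tuple mR => [the n.+1.-tuple mR of z.1 :: z.2]).

Section Cons.
Variables (n : nat) (mu : {sigma_finite_measure set (n.-tuple mR) -> \bar R}).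

Let mcons : measurable_fun [set: mR * n.-tuple mR] (cons_pair n).
Proof.
by apply: measurable_cons; [exact: measurable_fst | exact: measurable_snd].
Qed.

Definition leb_cons : set (n.+1.-tuple mR) -> \bar R :=
  pushforward ((@lebesgue_measure R : set mR -> \bar R) \x mu)%E (cons_pair n).

Let leb_cons0 : leb_cons set0 = 0%E.
Proof. by rewrite /leb_cons /pushforward preimage_set0 measure0. Qed.

Let leb_cons_ge0 A : (0 <= leb_cons A)%E.
Proof. by apply: measure_ge0. Qed.

Let leb_cons_sigma_additive : semi_sigma_additive leb_cons.
Proof.
exact: (@measure_semi_sigma_additive _ _ _
  (pushforward (lebesgue_measure \x mu)%E (cons_pair n)
     : {measure set _ -> \bar R})).
Qed.

HB.instance Definition _ := isMeasure.Build _ _ _ leb_cons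
  leb_cons0 leb_cons_ge0 leb_cons_sigma_additive.

Let leb_cons_sigma_finite : sigma_finite setT leb_cons.
Proof.
have /sigma_finiteP[F [TF ndF Foo]] := sigma_finiteT
  ((@lebesgue_measure R) : {sigma_finite_measure set mR -> \bar R}).
have /sigma_finiteP[G [TG ndG Goo]] := sigma_finiteT mu.
pose uncons (t : n.+1.-tuple mR) : mR * n.-tuple mR :=
  (thead t, [tuple of behead t]).
have consK (z : mR * n.-tuple mR) : uncons [the n.+1.-tuple mR of z.1 :: z.2] = z.
  by case: z => x t; rewrite /uncons /= theadE; congr pair; exact: val_inj.
have muncons : measurable_fun setT uncons.
  apply/measurable_fun_pairP; split; first exact: measurable_tnth.
  exact: measurable_behead.
exists (fun k => uncons @^-1` (F k `*` G k)).
  rewrite -preimage_bigcup -(preimage_setT uncons); congr (_ @^-1` _).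
  rewrite -setXTT TF TG predeqE => -[x y]; split.
    move=> [/= [p _ Fpx] [q _ Gqy]]; exists (maxn p q) => //; split.
    - by move: x Fpx; exact/subsetPset/ndF/leq_maxl.
    - by move: y Gqy; exact/subsetPset/ndG/leq_maxr.
  by move=> [p _ []/= ? ?]; split; exists p.
move=> k; have [mF Fk] := Foo k; have [mG Gk] := Goo k; split.
  rewrite -[X in measurable X]setTI; apply: muncons => //.
  exact: measurableX.
rewrite /leb_cons /pushforward -comp_preimage.
rewrite (_ : uncons \o _ = id); last by apply/funext => z /=; rewrite consK.
by rewrite preimage_id product_measure1E// lte_mul_pinfty// ge0_fin_numE.
Qed.

HB.instance Definition _ :=
  Measure_isSigmaFinite.Build _ _ _ leb_cons leb_cons_sigma_finite.

End Cons.

Fixpoint leb_tuple n : {sigma_finite_measure set (n.-tuple mR) -> \bar R} :=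
  match n with
  | 0 => dirac ([tuple] : 0.-tuple mR)
  | n'.+1 => leb_cons (leb_tuple n')
  end.

End LebesgueTuple.

Section VelocityIntegrals.
Variables (R : realType) (n : nat).
Implicit Type F : 'rV[R]_n -> R.

Definition vint_on (D : set 'rV[R]_n) F : R :=
  \int[leb_tuple R n]_(t in [set t | D (\row_i tnth t i)]) F (\row_i tnth t i).

Definition vint F : R := vint_on setT F.

(* The library norm on ['rV[R]_n] is the sup norm; this is the Euclidean one. *)
Definition enorm (v : 'rV[R]_n) : R := Num.sqrt (\sum_i v 0 i ^+ 2).

(* Integral for the surface measure of the unit sphere S^(n-1), the latter being
   sigma(A) = n * Leb {y | 0 < |y| <= 1 /\ y / |y| \in A}. *)
Definition sphere_int F : R :=
  n%:R * vint_on [set y | 0 < enorm y <= 1] (fun y => F ((enorm y)^-1 *: y)).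

End VelocityIntegrals.

Section Operators.
Variables (R : realType) (d : nat).
Local Notation V := 'rV[R]_d.
Implicit Types (g : V -> R) (v : V).

Definition post1 v vs (sg : V) : V :=
  2^-1 *: (v + vs) + (enorm (v - vs) / 2) *: sg.
Definition post2 v vs (sg : V) : V :=
  2^-1 *: (v + vs) - (enorm (v - vs) / 2) *: sg.

Definition collision (B : R -> V -> R) g v : R :=
  vint (fun vs => sphere_int (fun sg =>
    B (enorm (v - vs)) sg *
      (g (post1 v vs sg) * g (post2 v vs sg) - g v * g vs))).

Definition density g : R := vint g.
Definition mean_velocity g : V :=
  \row_i (vint (fun v => v 0 i * g v) / density g).
Definition temperature g : R :=
  vint (fun v => enorm (v - mean_velocity g) ^+ 2 * g v) / (d%:R * density g).

Definition maxwellian g v : R :=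
  density g / (2 * pi * temperature g) `^ (d%:R / 2) *
  expR (- (enorm (v - mean_velocity g) ^+ 2 / (2 * temperature g))).

Definition QP (beta : (V -> R) -> R) g v : R :=
  beta g * (maxwellian g v - g v).

Definition GP (B : R -> V -> R) (beta : (V -> R) -> R) g v : R :=
  collision B g v - QP beta g v.

Definition decay_le (k : nat) (C : R) g : Prop :=
  forall v, (1 + enorm v) ^+ k * `|g v| <= C.

Definition op_bounded (K : set (V -> R)) (P : (V -> R) -> V -> R) : Prop :=
  forall k, exists C, forall g, K g -> decay_le k C (P g).

(* P(h) = P(g) + O(h - g) for rapidly decaying velocity distributions.  A loss
   of weight ([l] larger than [k]) is allowed, as hard potentials need it. *)
Definition op_lipschitz (K : set (V -> R)) (P : (V -> R) -> V -> R) : Prop :=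
  forall k, exists l L, forall g h C, K g -> K h ->
    decay_le l C (fun v => h v - g v) ->
    decay_le k (L * C) (fun v => P h v - P g v).

End Operators.

(* [d.+1] is the velocity dimension and [v 0 0] the first component of [v]. *)
Section Kinetic.
Variables (R : realType) (d : nat).
Local Notation V := 'rV[R]_d.+1.

(* Joint differentiability in (t, x) is what turns the equation into an ODE
   along the characteristics of the transport part. *)
Definition boltzmann_solution (B : R -> V -> R) (eps T : R)
    (f : R -> R -> V -> R) : Prop :=
  forall t x v, 0 <= t <= T ->
    differentiable (fun z : R * R => f z.1 z.2 v) (t, x) /\
    derive1 (fun s => f s x v) t + v 0 0 * derive1 (fun y => f t y v) x
      = eps^-1 * collision B (f t x) v.

(* [transport dt (c i - c j)] is the operator S_(i,j). *)
Definition transport (dt gam : R) (g : R -> V -> R) (x : R) (v : V) : R :=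
  g (x - gam * v 0 0 * dt) v.

End Kinetic.

(* Tableaux have [s = 1 + m] stages; stage i of the mathematical numbering is
   the ordinal of value i - 1 in ['I_(1 + m)].  The hatted matrices are indexed
   by ['I_m]: the row [i : 'I_m], of value i, belongs to the stage
   [rshift 1 i], i.e. to stage i + 2, for which B and D have i entries. *)
Section Tableaux.
Variables (R : realType) (m : nat).
Implicit Types (A At : 'M[R]_(1 + m)) (b bt : 'rV[R]_(1 + m)).
Implicit Types (C : 'M[R]_m) (i : 'I_m).

Definition explicit_tableau A : Prop :=
  forall i j : 'I_(1 + m), (i <= j)%N -> A i j = 0.
Definition implicit_tableau At : Prop :=
  forall i j : 'I_(1 + m), (i < j)%N -> At i j = 0.

Definition abscissa A (i : 'I_(1 + m)) : R := \sum_j A i j.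

Definition tab_a A : 'cV[R]_m := dlsubmx A.
Definition tab_hat A : 'M[R]_m := drsubmx A.

Definition type_CK_ARS A At bt : Prop :=
  [/\ A = block_mx 0 0 (tab_a A) (tab_hat A),
      At = block_mx 0 0 0 (tab_hat At),
      tab_hat At \in unitmx &
      bt 0 (lshift m 0) = 0].

Definition GSA A At b bt : Prop :=
  row (@ord_max m) A = b /\ row (@ord_max m) At = bt.

Definition wid i : 'I_i -> 'I_m := widen_ord (ltnW (ltn_ord i)).

Definition lead_block C i : 'M[R]_i := \matrix_(p, q) C (wid p) (wid q).
Definition lead_vec (w : 'cV[R]_m) i : 'cV[R]_i := \col_p w (wid p) 0.
Definition bar_row C i : 'rV[R]_i := \row_q C i (wid q).

Definition coefB At i : 'rV[R]_i :=
  bar_row (tab_hat At) i *m invmx (lead_block (tab_hat At) i).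
Definition coefD A At i : 'rV[R]_i :=
  bar_row (tab_hat A) i - coefB At i *m lead_block (tab_hat A) i.
Definition coefd A At i : R :=
  tab_a A i 0 - (coefB At i *m lead_vec (tab_a A) i) 0 0.

Definition stage i : 'I_(1 + m) := rshift 1 i.

Definition g_recursion At (g : 'I_(1 + m) -> R) : Prop :=
  g (lshift m 0) = 0 /\
  forall i, g (stage i) =
    \sum_(j < i) coefB At i 0 j * g (stage (wid j)) + tab_hat At i i.

Definition h_recursion A At (h : 'I_(1 + m) -> R) : Prop :=
  h (lshift m 0) = 0 /\
  forall i, h (stage i) =
    \sum_(j < i) (coefB At i 0 j * h (stage (wid j)) + coefD A At i 0 j)
    + coefd A At i.

Section Scheme.
Variables (d : nat) (B : R -> 'rV[R]_d.+1 -> R) (beta : ('rV[R]_d.+1 -> R) -> R).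
Local Notation phase := (R -> 'rV[R]_d.+1 -> R).

(* [fn], [F i] and [fn1] are f^n, f^(i) and f^(n+1).  The abscissa c_0 = 0 is
   attached to f^n. *)
Definition shu_osher_step A At (eps dt : R) (fn : phase)
    (F : 'I_(1 + m) -> phase) (fn1 : phase) : Prop :=
  let c := abscissa A in
  let S0 p := transport dt (c p - 0) in
  let S p q := transport dt (c p - c q) in
  let Q_P (f : phase) : phase := fun x => QP beta (f x) in
  let G_P (f : phase) : phase := fun x => GP B beta (f x) in
  [/\ forall x v, F (lshift m 0) x v = S0 (lshift m 0) fn x v,
      forall i x v, F (stage i) x v =
        (1 - \sum_(j < i) coefB At i 0 j) * S0 (stage i) fn x v
        + \sum_(j < i) coefB At i 0 j
            * S (stage i) (stage (wid j)) (F (stage (wid j))) x v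
        + dt / eps * tab_hat At i i * Q_P (F (stage i)) x v
        + dt / eps * \sum_(j < i) coefD A At i 0 j
            * S (stage i) (stage (wid j)) (G_P (F (stage (wid j)))) x v
        + dt / eps * coefd A At i * S0 (stage i) (G_P fn) x v &
      fn1 = F (@ord_max m)].

End Scheme.
End Tableaux.

(* Main.v *)
(* The recursion for g reproduces the row sums of the implicit tableau, so that
   g_s = 1 forces c_s = 1.  Moving every stage back to the foot of its
   characteristic, where S_(i,j) S_(j,0) = S_(i,0) holds exactly, induction on
   the stages first gives f^(i) = S_(i,0)[f^n] + O(dt / eps) from the
   boundedness of the operators, and then, by their Lipschitz continuity,
     f^(i) = S_(i,0)[f^n + (dt / eps) (g_i Q_P(f^n) + h_i G_P(f^n))]
             + O((dt / eps)^2),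
   where Q_P + G_P = Q.  For i = s and g_s = h_s = 1 this agrees with the
   expansion of the exact solution along the characteristic.  All remainders
   are measured in the norms with weight (1 + |v|)^k, because transport over
   the time dt moves f(., v) by a distance of order |v| dt. *)

Require Import Defs.
From HB Require Import structures.
From mathcomp Require Import all_boot all_order all_algebra.
From mathcomp Require Import all_classical all_reals all_analysis.
From mathcomp Require Import ring.

Set Implicit Arguments.
Unset Strict Implicit.
Unset Printing Implicit Defensive.

Import Order.TTheory GRing.Theory Num.Theory.
Import numFieldNormedType.Exports.

Local Open Scope classical_set_scope.
Local Open Scope ring_scope.

(** * Polynomial velocity weights and differences of operators *)

Section EuclideanNorm.
Variables (R : realType) (d : nat).
Implicit Types v : 'rV[R]_d.

Lemma enorm_ge0 v : 0 <= enorm v.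
Proof. exact: sqrtr_ge0. Qed.

Lemma ler_coord_enorm v i : `|v 0 i| <= enorm v.
Proof.
rewrite -sqrtr_sqr ler_wsqrtr// (bigD1 i)//= lerDl.
by apply: sumr_ge0 => j _; exact: sqr_ge0.
Qed.

Lemma weight_ge1 v k : 1 <= (1 + enorm v) ^+ k.
Proof. by rewrite exprn_ege1// lerDl enorm_ge0. Qed.

Lemma weight_ge0 v k : 0 <= (1 + enorm v) ^+ k.
Proof. exact: le_trans (weight_ge1 v k). Qed.

Lemma decay_le_ge0 k (C : R) (g : 'rV[R]_d -> R) : decay_le k C g -> 0 <= C.
Proof.
by move=> /(_ 0); apply: le_trans; rewrite mulr_ge0 ?weight_ge0.
Qed.

Lemma decay_leW k l (C : R) (g : 'rV[R]_d -> R) :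
  (k <= l)%N -> decay_le l C g -> decay_le k C g.
Proof.
move=> kl gC v; apply: le_trans (gC v); rewrite ler_wpM2r// ler_weXn2l//.
by rewrite lerDl enorm_ge0.
Qed.

(** Meant for [GP], the difference of [collision] and [QP]. The two may lose different weights, so
    the input is measured with the larger one. *)
Lemma op_lipschitzB (K : set ('rV[R]_d -> R)) P1 P2 :
  op_lipschitz K P1 -> op_lipschitz K P2 ->
  op_lipschitz K (fun g v => P1 g v - P2 g v).
Proof.
move=> P1l P2l k; have [l1 [L1 H1]] := P1l k; have [l2 [L2 H2]] := P2l k.
exists (maxn l1 l2), (L1 + L2) => g h C Kg Kh gh v.
have -> : P1 h v - P2 h v - (P1 g v - P2 g v)
        = (P1 h v - P1 g v) - (P2 h v - P2 g v) by ring.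
rewrite mulrDl; have := H1 _ _ _ Kg Kh (decay_leW (leq_maxl _ _) gh) v.
have := H2 _ _ _ Kg Kh (decay_leW (leq_maxr l1 _) gh) v.
move=> le2 le1; apply: le_trans (lerD le1 le2).
by rewrite -mulrDr ler_wpM2l ?weight_ge0// ler_normB.
Qed.

Lemma op_boundedB (K : set ('rV[R]_d -> R)) P1 P2 :
  op_bounded K P1 -> op_bounded K P2 ->
  op_bounded K (fun g v => P1 g v - P2 g v).
Proof.
move=> P1b P2b k; have [C1 H1] := P1b k; have [C2 H2] := P2b k.
exists (C1 + C2) => g Kg v; apply: le_trans (lerD (H1 _ Kg v) (H2 _ Kg v)).
by rewrite -mulrDr ler_wpM2l ?weight_ge0// ler_normB.
Qed.

End EuclideanNorm.

(** * Differentiation along characteristics *)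

Section Characteristics.
Variable R : realType.

(** The differential is linear in the direction, so the derivative along [(a, b)] splits into the
    two partials. With [(a, b) = (1, v 0 0)] this is the transport operator. *)
Lemma is_derive_affine (u : R * R -> R) (t0 x0 a b s : R) :
  differentiable u (t0 + s * a, x0 + s * b) ->
  is_derive s 1 (fun r => u (t0 + r * a, x0 + r * b))
    (a * derive1 (fun t => u (t, x0 + s * b)) (t0 + s * a) +
     b * derive1 (fun x => u (t0 + s * a, x)) (x0 + s * b)).
Proof.
(* Both difference quotients are those of [u] in the direction [(a, b)]. *)
have line (y z c e r : R) : differentiable u (y + r * c, z + r * e) ->
    is_derive r 1 (fun q => u (y + q * c, z + q * e))
      ('d u (y + r * c, z + r * e) (c, e)).
  move=> du; have := diff_derivable (v := (c, e)) du.
  rewrite -(deriveE _ du) /derivable /derive => cu.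
  have eq_quot : (fun k : R => k^-1 *: (u (k *: (c, e) + (y + r * c, z + r * e)) -
                                  u (y + r * c, z + r * e))) =
      (fun k => k^-1 *: ((fun q => u (y + q * c, z + q * e)) (k *: 1 + r) -
                         u (y + r * c, z + r * e))).
    apply/funext => k; congr (_ *: (u _ - _)).
    by rewrite [k *: 1]mulr1; congr pair; rewrite /= mulrDl addrCA.
  rewrite eq_quot in cu *; exact: DeriveDef.
move=> du.
have -> : derive1 (fun t => u (t, x0 + s * b)) (t0 + s * a) =
          'd u (t0 + s * a, x0 + s * b) (1, 0).
  have := line 0 (x0 + s * b) 1 0 (t0 + s * a).
  rewrite mulr0 mulr1 addr0 add0r => /(_ du) /@derive_val.
  rewrite -derive1E => <-; congr (derive1 _ _).
  by apply/funext => r; rewrite mulr0 mulr1 addr0 add0r.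
have -> : derive1 (fun x => u (t0 + s * a, x)) (x0 + s * b) =
          'd u (t0 + s * a, x0 + s * b) (0, 1).
  have := line (t0 + s * a) 0 0 1 (x0 + s * b).
  rewrite mulr0 mulr1 addr0 add0r => /(_ du) /@derive_val.
  rewrite -derive1E => <-; congr (derive1 _ _).
  by apply/funext => r; rewrite mulr0 mulr1 addr0 add0r.
have := line _ _ _ _ _ du.
rewrite (_ : (a, b) = a *: (1, 0) + b *: (0, 1)); last first.
  by congr pair; rewrite /= /GRing.scale/= ?mulr0 ?mulr1 ?addr0 ?add0r.
by rewrite linearD !linearZ.
Qed.

Lemma lipschitz_of_derive_bound (u : R -> R) (M : R) :
  (forall x, derivable u x 1) -> (forall x, `|derive1 u x| <= M) ->
  forall x y, `|u x - u y| <= M * `|x - y|.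
Proof.
move=> du uM x y; wlog lexy : x y / x <= y => [wlog_le|].
  by have [/wlog_le//|/ltW/wlog_le] := leP x y; rewrite distrC [`|y - _|]distrC.
have [||z _] := @MVT_segment _ u (derive1 u) x y lexy.
- by move=> z _; rewrite derive1E; exact: derivableP.
- by apply: derivable_within_continuous => z _; exact: du.
rewrite [`|u x - _|]distrC [`|x - y|]distrC => ->; rewrite normrM.
exact: ler_wpM2r.
Qed.

(** The mean value theorem takes the place of a Taylor expansion: along the characteristic the
    derivative is the collision term alone. The intermediate time [s] depends on [x] and [v]. *)
Lemma boltzmann_characteristic d (B : R -> 'rV[R]_d.+1 -> R) eps T f t0 tau x v :
  boltzmann_solution B eps T f -> 0 <= t0 -> 0 <= tau -> t0 + tau <= T ->
  exists2 s, 0 <= s <= tau &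
    f (t0 + tau) x v - f t0 (x - tau * v 0 0) v =
      tau * (eps^-1 * collision B (f (t0 + s) (x - (tau - s) * v 0 0)) v).
Proof.
move=> sol t0_ge0 tau_ge0 leT.
pose q (s : R) : R := f (t0 + s * 1) (x - tau * v 0 0 + s * v 0 0) v.
pose dq (s : R) : R := eps^-1 * collision B (f (t0 + s) (x - (tau - s) * v 0 0)) v.
have qdq s : 0 <= s <= tau -> is_derive s 1 q (dq s).
  move=> /andP[s0 stau].
  have [|df] := sol (t0 + s * 1) (x - tau * v 0 0 + s * v 0 0) v.
    by rewrite mulr1 addr_ge0//= (le_trans _ leT)// lerD2l.
  have := is_derive_affine df; rewrite /= mul1r => + eqf; rewrite eqf mulr1.
  by rewrite (_ : x - tau * _ + _ = x - (tau - s) * v 0 0)//; ring.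
have qc : {within `[0, tau], continuous q}.
  apply: derivable_within_continuous => s; rewrite in_itv/= => /qdq qds.
  exact: (@ex_derive _ _ _ _ _ _ _ qds).
have qo s : s \in `]0, tau[ -> is_derive s 1 q (dq s).
  by rewrite in_itv/= => /andP[/ltW s0 /ltW st]; apply: qdq; rewrite s0.
have [s] := MVT_segment tau_ge0 qo qc; rewrite in_itv/= => stau.
rewrite /q !mul0r !addr0 mulr1 subrK subr0 => ->; exists s => //.
exact: mulrC.
Qed.

End Characteristics.

(** * Row sums of the triangular tableaux *)

Section TableauLemmas.
Variables (R : realType) (m : nat).
Implicit Types (A At : 'M[R]_(1 + m)) (C : 'M[R]_m).

Lemma sum_lower_row C (i : 'I_m) :
  (forall j : 'I_m, (i < j)%N -> C i j = 0) ->
  \sum_j C i j = \sum_(j < i) C i (wid j) + C i i.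
Proof.
move=> Ci0; rewrite (bigID (fun j : 'I_m => (j < i)%N))/=; congr (_ + _).
  by rewrite (big_ord_narrow (ltnW (ltn_ord i))).
rewrite (bigD1 i) ?ltnn//= big1 ?addr0// => j /andP[nji neq].
by apply: Ci0; rewrite ltn_neqAle eq_sym neq leqNgt.
Qed.

(** The determinant of a triangular matrix is the product of its diagonal, and the diagonal of the
    block is part of that of [C]. *)
Lemma lead_block_unitmx C (i : 'I_m) :
  is_trig_mx C -> C \in unitmx -> lead_block C i \in unitmx.
Proof.
move=> Ct; have Clt : is_trig_mx (lead_block C i).
  by apply/is_trig_mxP => p q pq; rewrite mxE; exact: (is_trig_mxP Ct).
rewrite !unitmxE !unitfE !det_trig// => /prodf_neq0 Cii.
by apply/prodf_neq0 => p _; rewrite mxE; exact: Cii.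
Qed.

(* The rows of [tab_hat At] satisfy [bar_row = coefB *m lead_block], so the
   recursion for [g] only sums the rows of [At]. *)
Lemma g_recursion_abscissa A At bt g :
  implicit_tableau At -> type_CK_ARS A At bt -> g_recursion At g ->
  forall p, abscissa At p = g p.
Proof.
move=> At0 [_ AtE Atu _] [g0 gS].
have hatE i j : tab_hat At i j = At (stage i) (stage j).
  by rewrite /tab_hat /drsubmx !mxE.
have col0 i : At (stage i) (lshift m 0) = 0 by rewrite AtE block_mxEdl mxE.
have hat0 (i j : 'I_m) : (i < j)%N -> tab_hat At i j = 0.
  by move=> ij; rewrite hatE At0//= ltn_add2l.
have absE i : abscissa At (stage i) =
    \sum_(j < i) tab_hat At i (wid j) + tab_hat At i i.
  rewrite /abscissa big_split_ord/= big_ord_recl big_ord0 addr0.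
  rewrite col0 add0r -(sum_lower_row (hat0 _)).
  by apply: eq_bigr => j _; rewrite hatE.
have trig : is_trig_mx (tab_hat At) by apply/is_trig_mxP.
have main k (i : 'I_m) : (i < k)%N -> abscissa At (stage i) = g (stage i).
  elim: k i => // k IH i ik; rewrite gS absE; congr (_ + _).
  have barE : Defs.coefB At i *m lead_block (tab_hat At) i = bar_row (tab_hat At) i.
    by rewrite mulmxKV// lead_block_unitmx.
  transitivity (\sum_q bar_row (tab_hat At) i 0 q).
    by apply: eq_bigr => q _; rewrite [bar_row _ _ _ _]mxE.
  (* After the exchange, the inner sum runs over the first [i] entries of row [p] with [p < i]. The
     entries left out lie right of the diagonal, so it is the whole row sum, known by induction. *)
  rewrite -barE; under eq_bigr do rewrite mxE; rewrite exchange_big/=.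
  apply: eq_bigr => p _; rewrite -mulr_sumr -IH; last first.
    by rewrite (leq_trans (ltn_ord p)).
  congr (_ * _); rewrite absE -(sum_lower_row (hat0 _)).
  rewrite [RHS](bigID (fun j : 'I_m => (j < i)%N))/= [X in _ + X]big1 ?addr0.
    rewrite (big_ord_narrow (ltnW (ltn_ord i))).
    by apply: eq_bigr => q _; rewrite [lead_block _ _ _ _]mxE.
  by move=> j nji; apply: hat0; rewrite /= (leq_trans (ltn_ord p))// leqNgt.
move=> p; have [i ->|i ->] := split_ordP p; last exact: (main i.+1).
rewrite (ord1 i) g0 /abscissa big1// => j _; rewrite AtE.
by have [k ->|k ->] := split_ordP j; rewrite ?block_mxEul ?block_mxEur mxE.
Qed.

End TableauLemmas.

(** * Calculus of remainders of order [(dt / eps) ^+ p] in all weights *)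

Section WeightedBigO.
Variables (R : realType) (d : nat) (eps0 : R) (adm : R -> R -> nat -> Prop).
Hypothesis hadm : forall eps dt n, adm eps dt n -> 0 < eps <= eps0 /\ 0 < dt.
Local Notation V := 'rV[R]_d.+1.

Definition kinetic_family := R -> R -> nat -> R -> V -> R.
Implicit Types (E u : kinetic_family) (P : (V -> R) -> V -> R) (K : set (V -> R)).

(** The constant is uniform in [eps], [dt], [n] and [x]. All weights [k] are demanded at once
    because shifts and operators each consume some of them. *)
Definition decayO p E := forall k, exists C, forall eps dt n x,
  adm eps dt n -> decay_le k (C * (dt / eps) ^+ p) (E eps dt n x).

Definition x_lipschitz u := forall k, exists C, forall eps dt n x y,
  adm eps dt n ->
  decay_le k (C * `|x - y|) (fun v => u eps dt n x v - u eps dt n y v).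

Definition in_class K u := forall eps dt n x, adm eps dt n -> K (u eps dt n x).

Definition advect (gam : R) u : kinetic_family :=
  fun eps dt n => transport dt gam (u eps dt n).

Lemma ratio_ge0 eps dt n p : adm eps dt n -> 0 <= (dt / eps) ^+ p.
Proof.
by move=> /hadm[/andP[e0 _] t0]; rewrite exprn_ge0// divr_ge0 ?ltW.
Qed.

Lemma decayO_ext p E1 E2 :
  (forall eps dt n x v, adm eps dt n -> E2 eps dt n x v = E1 eps dt n x v) ->
  decayO p E1 -> decayO p E2.
Proof.
move=> E12 O1 k; have [C hC] := O1 k; exists C => eps dt n x ad v.
by rewrite E12//; exact: hC.
Qed.

Lemma decayO0 p : decayO p (fun _ _ _ _ _ => 0).
Proof.
by move=> k; exists 0 => eps dt n x ad v; rewrite normr0 mulr0 mul0r.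
Qed.

Lemma decayOD p E1 E2 : decayO p E1 -> decayO p E2 ->
  decayO p (fun eps dt n x v => E1 eps dt n x v + E2 eps dt n x v).
Proof.
move=> O1 O2 k; have [C1 h1] := O1 k; have [C2 h2] := O2 k.
exists (C1 + C2) => eps dt n x ad v; rewrite mulrDl.
apply: le_trans (lerD (h1 _ _ _ x ad v) (h2 _ _ _ x ad v)).
by rewrite -mulrDr ler_wpM2l ?weight_ge0// ler_normD.
Qed.

Lemma decayOZ p a E : decayO p E -> decayO p (fun eps dt n x v => a * E eps dt n x v).
Proof.
move=> O1 k; have [C hC] := O1 k; exists (`|a| * C) => eps dt n x ad v.
by rewrite normrM mulrCA -mulrA ler_wpM2l//; exact: hC.
Qed.

Lemma decayOB p E1 E2 : decayO p E1 -> decayO p E2 ->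
  decayO p (fun eps dt n x v => E1 eps dt n x v - E2 eps dt n x v).
Proof.
move=> O1 /(decayOZ (-1)) O2; apply: decayO_ext (decayOD O1 O2) => *.
by rewrite mulN1r.
Qed.

Lemma decayO_sum p k (E : 'I_k -> kinetic_family) : (forall j, decayO p (E j)) ->
  decayO p (fun eps dt n x v => \sum_(j < k) E j eps dt n x v).
Proof.
elim: k E => [|k IH] E OE.
  by apply: decayO_ext (decayO0 p) => *; rewrite big_ord0.
apply: decayO_ext (decayOD (OE ord0) (IH _ (fun j => OE (lift ord0 j)))) => *.
by rewrite big_ord_recl.
Qed.

Lemma decayO_step p E :
  decayO p E -> decayO p.+1 (fun eps dt n x v => dt / eps * E eps dt n x v).
Proof.
move=> OE k; have [C hC] := OE k; exists C => eps dt n x ad v.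
have r0 := ratio_ge0 1 ad; rewrite expr1 in r0.
rewrite normrM (ger0_norm r0) mulrCA exprS [leRHS]mulrCA ler_wpM2l//.
exact: hC.
Qed.

(** The shift of [x] depends on [v], but the bound is pointwise in [v] and uniform in [x]. *)
Lemma decayO_advect p gam E : decayO p E -> decayO p (advect gam E).
Proof.
by move=> OE k; have [C hC] := OE k; exists C => eps dt n x ad v; exact: hC.
Qed.

Lemma op_bounded_decayO K P u : op_bounded K P -> in_class K u ->
  decayO 0 (fun eps dt n x => P (u eps dt n x)).
Proof.
move=> Pb Ku k; have [C hC] := Pb k; exists C => eps dt n x ad.
by rewrite expr0 mulr1; exact/hC/Ku.
Qed.

Lemma op_lipschitz_decayO K P u1 u2 : op_lipschitz K P ->
  in_class K u1 -> in_class K u2 ->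
  decayO 1 (fun eps dt n x v => u2 eps dt n x v - u1 eps dt n x v) ->
  decayO 1 (fun eps dt n x v => P (u2 eps dt n x) v - P (u1 eps dt n x) v).
Proof.
move=> Pl K1 K2 O12 k; have [l [L hL]] := Pl k; have [C hC] := O12 l.
exists (L * C) => eps dt n x ad; rewrite -mulrA.
by apply: hL; [exact: K1|exact: K2|exact: hC].
Qed.

Lemma x_lipschitz_op K P u : op_lipschitz K P -> in_class K u ->
  x_lipschitz u -> x_lipschitz (fun eps dt n x => P (u eps dt n x)).
Proof.
move=> Pl Ku ul k; have [l [L hL]] := Pl k; have [C hC] := ul l.
exists (L * C) => eps dt n x y ad; rewrite -mulrA.
by apply: hL; [exact: Ku|exact: Ku|exact: hC].
Qed.

(** The distance [gam * v 0 0 * dt] costs one power of the weight, hence [k.+1]; the bound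
    [dt <= eps0 * (dt / eps)] turns it into a remainder of order one. *)
Lemma x_lipschitz_advect gam u : x_lipschitz u ->
  decayO 1 (fun eps dt n x v => advect gam u eps dt n x v - u eps dt n x v).
Proof.
move=> ul k; have [C hC] := ul k.+1.
exists (`|C| * `|gam| * eps0) => eps dt n x ad v.
have [/andP[e0 ee0] t0] := hadm ad.
have wv := weight_ge1 v 1; rewrite expr1 in wv.
have := hC _ _ _ (x - gam * v 0 0 * dt) x ad v.
rewrite /advect /transport exprS -mulrA => le1.
rewrite -(ler_pM2l (lt_le_trans ltr01 wv)); apply: le_trans le1 _.
have -> : x - gam * v 0 0 * dt - x = - (gam * v 0 0 * dt) by ring.
rewrite normrN !normrM (gtr0_norm t0) expr1.
have vv : `|v 0 0| <= 1 + enorm v.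
  by rewrite (le_trans (ler_coord_enorm v 0))// lerDr.
have dte : dt <= eps0 * (dt / eps).
  by rewrite mulrCA ler_peMr ?(ltW t0)// ler_pdivlMr// mul1r.
have -> : (1 + enorm v) * (`|C| * `|gam| * eps0 * (dt / eps)) =
   `|C| * (`|gam| * (1 + enorm v) * (eps0 * (dt / eps))) by ring.
have gv : 0 <= `|gam| * `|v 0 0| * dt by rewrite !mulr_ge0// ltW.
apply: le_trans (ler_wpM2r gv (ler_norm C)) _; rewrite ler_wpM2l//.
by rewrite ler_pM ?mulr_ge0 ?(ltW t0)// ler_wpM2l.
Qed.

(** [P] acts on a velocity profile at fixed [x], whereas [advect] moves each velocity differently,
    so the two do not commute. Both terms are compared with the unshifted [P u], at a cost of order
    one. *)
Lemma op_advect_decayO K P gam u w : op_lipschitz K P ->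
  in_class K u -> in_class K w -> x_lipschitz u ->
  decayO 1 (fun eps dt n x v => w eps dt n x v - advect gam u eps dt n x v) ->
  decayO 1 (fun eps dt n x v => P (w eps dt n x) v -
            advect gam (fun eps dt n x => P (u eps dt n x)) eps dt n x v).
Proof.
move=> Pl Ku Kw ul Ow.
have Owu : decayO 1 (fun eps dt n x v => w eps dt n x v - u eps dt n x v).
  apply: decayO_ext (decayOD Ow (x_lipschitz_advect gam ul)) => *.
  by rewrite addrA subrK.
have OP := op_lipschitz_decayO Pl Ku Kw Owu.
apply: decayO_ext (decayOB OP (x_lipschitz_advect gam (x_lipschitz_op Pl Ku ul))) => *.
by rewrite opprB addrA subrK.
Qed.

End WeightedBigO.

(** * Expansion of the stages of the scheme *)

Section Scheme.
Variables (R : realType) (d m : nat) (eps0 : R) (adm : R -> R -> nat -> Prop).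
Hypothesis hadm : forall eps dt n, adm eps dt n -> 0 < eps <= eps0 /\ 0 < dt.
Local Notation V := 'rV[R]_d.+1.
Variables (B : R -> V -> R) (beta : (V -> R) -> R) (K : set (V -> R)).
Hypotheses (Qb : op_bounded K (collision B)) (Pb : op_bounded K (QP beta)).
Hypotheses (Ql : op_lipschitz K (collision B)) (Pl : op_lipschitz K (QP beta)).
Variables (A At : 'M[R]_(1 + m)) (g h : 'I_(1 + m) -> R).
Hypotheses (hg : g_recursion At g) (hh : h_recursion A At h).
Variables (u : kinetic_family R d) (F : 'I_(1 + m) -> kinetic_family R d).
Hypothesis Ku : in_class adm K u.
Hypothesis KF : forall p, in_class adm K (F p).
Hypothesis ul : x_lipschitz adm u.
Hypothesis hF : forall eps dt n, adm eps dt n ->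
  shu_osher_step B beta A At eps dt (u eps dt n) (fun p => F p eps dt n)
    (F (@ord_max m) eps dt n).

Local Notation c := (abscissa A).
Local Notation coefB := (Defs.coefB At).
Local Notation coefD := (Defs.coefD A At).
Local Notation QPf E :=
  (fun eps dt n x => QP beta ((E : kinetic_family R d) eps dt n x)).
Local Notation GPf E :=
  (fun eps dt n x => GP B beta ((E : kinetic_family R d) eps dt n x)).

Lemma advect_advect (a b : R) (E : kinetic_family R d) eps dt n x v :
  advect (a - b) (advect b E) eps dt n x v = advect a E eps dt n x v.
Proof. by rewrite /advect /transport; congr (E eps dt n _ v); ring. Qed.

Lemma all_stages (T : 'I_(1 + m) -> Prop) : T (lshift m 0) ->
  (forall i : 'I_m, (forall j : 'I_i, T (stage (wid j))) -> T (stage i)) ->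
  forall p, T p.
Proof.
move=> T0 TS p; have [i ->|i ->] := split_ordP p; first by rewrite (ord1 i).
suff: forall k (j : 'I_m), (j < k)%N -> T (stage j) by move/(_ i.+1); apply.
elim=> // k IH j jk; apply: TS => l; apply: IH.
exact: leq_trans (ltn_ord l) jk.
Qed.

(** The stage equation is implicit in [F (stage i)], but [KF] bounds its [QP] term a priori, so it
    is treated as a remainder like the others. *)
Lemma stage_order1 p : decayO adm 1 (fun eps dt n x v =>
  F p eps dt n x v - advect (c p) u eps dt n x v).
Proof.
move: p; apply: all_stages => [|i IH].
  apply: decayO_ext (@decayO0 _ _ _ 1) => eps dt n x v ad.
  by have [-> _ _] := hF ad; rewrite subr0 subrr.
have OQ := op_bounded_decayO Pb (KF (stage i)).
have Gb : op_bounded K (GP B beta) := op_boundedB Qb Pb.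
have OD := decayO_sum (fun j : 'I_i => decayOZ (coefD i 0 j)
  (decayO_advect (c (stage i) - c (stage (wid j)))
    (op_bounded_decayO Gb (KF (stage (wid j)))))).
have Od := decayOZ (coefd A At i) (decayO_advect (c (stage i)) (op_bounded_decayO Gb Ku)).
have OB := decayO_sum (fun j : 'I_i => decayOZ (coefB i 0 j)
  (decayO_advect (c (stage i) - c (stage (wid j))) (IH j))).
apply: decayO_ext (decayOD OB (decayO_step hadm
  (decayOD (decayOD (decayOZ (tab_hat At i i) OQ) OD) Od))) => eps dt n x v ad.
have [_ -> _] := hF ad; rewrite subr0.
set Y := advect (c (stage i)) u eps dt n x v.
rewrite [transport _ _ (u _ _ _) _ _](_ : _ = Y)//.
(* The coefficients of the transported terms add up to one. Writing [Y] as a shift of each earlier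
   foot value lets the sum over [coefB] cancel the missing part of [Y]. *)
rewrite [X in _ = X + _](_ : _ = \sum_(j < i) coefB i 0 j *
    transport dt (c (stage i) - c (stage (wid j))) (F (stage (wid j)) eps dt n) x v
    - (\sum_(j < i) coefB i 0 j) * Y); last first.
  rewrite mulr_suml -sumrB; apply: eq_bigr => j _.
  by rewrite -mulrBr /Y -(advect_advect (c (stage i)) (c (stage (wid j)))).
rewrite /advect; ring.
Qed.

(** The first-order errors of [stage_order1] enter through operators multiplied by [dt / eps], and
    so gain one order. The recursions for [g] and [h] collect the resulting coefficients of [QP] and
    [GP] at the foot. *)
Lemma stage_order2 p : decayO adm 2 (fun eps dt n x v =>
  F p eps dt n x v - (advect (c p) u eps dt n x v + dt / eps *
    (g p * advect (c p) (QPf u) eps dt n x v +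
     h p * advect (c p) (GPf u) eps dt n x v))).
Proof.
move: p; apply: all_stages => [|i IH].
  apply: decayO_ext (@decayO0 _ _ _ 2) => eps dt n x v ad.
  have [-> _ _] := hF ad; have [-> _] := hg; have [-> _] := hh.
  by rewrite subr0 !mul0r addr0 mulr0 addr0 subrr.
have Gl : op_lipschitz K (GP B beta) := op_lipschitzB Ql Pl.
have OQ := op_advect_decayO hadm Pl Ku (KF (stage i)) ul (stage_order1 (stage i)).
have OD := decayO_sum (fun j : 'I_i => decayOZ (coefD i 0 j)
  (decayO_advect (c (stage i) - c (stage (wid j)))
    (op_advect_decayO hadm Gl Ku (KF (stage (wid j))) ul
      (stage_order1 (stage (wid j)))))).
have OB := decayO_sum (fun j : 'I_i => decayOZ (coefB i 0 j)
  (decayO_advect (c (stage i) - c (stage (wid j))) (IH j))).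
apply: decayO_ext (decayOD OB (decayO_step hadm
  (decayOD (decayOZ (tab_hat At i i) OQ) OD))) => eps dt n x v ad.
have [_ -> _] := hF ad; rewrite subr0.
have [_ ->] := hg; have [_ ->] := hh; rewrite big_split/=.
set Y := advect (c (stage i)) u eps dt n x v.
set Q := advect (c (stage i)) (QPf u) eps dt n x v.
set G := advect (c (stage i)) (GPf u) eps dt n x v.
rewrite [transport _ _ (u _ _ _) _ _](_ : _ = Y)//.
rewrite [transport _ _ (fun y => GP B beta (u _ _ _ y)) _ _](_ : _ = G)//.
pose S (E : kinetic_family R d) (j : 'I_i) :=
  advect (c (stage i) - c (stage (wid j))) E eps dt n x v.
rewrite [X in _ = X + _](_ : _ =
    \sum_(j < i) coefB i 0 j * S (F (stage (wid j))) j
    - (\sum_(j < i) coefB i 0 j) * Y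
    - dt / eps * ((\sum_(j < i) coefB i 0 j * g (stage (wid j))) * Q +
                  (\sum_(j < i) coefB i 0 j * h (stage (wid j))) * G)); last first.
  rewrite !mulr_suml -big_split/= mulr_sumr -!sumrB; apply: eq_bigr => j _.
  rewrite /Y /Q /G -!(advect_advect (c (stage i)) (c (stage (wid j)))) /S /advect /transport.
  ring.
rewrite [X in _ = _ + _ * (_ + X)](_ : _ =
    \sum_(j < i) coefD i 0 j * S (GPf (F (stage (wid j)))) j
    - (\sum_(j < i) coefD i 0 j) * G); last first.
  rewrite mulr_suml -sumrB; apply: eq_bigr => j _.
  rewrite /G -(advect_advect (c (stage i)) (c (stage (wid j)))) /S /advect /transport.
  ring.
rewrite /S /advect; ring.
Qed.

End Scheme.

(** * Expansion of the exact solution over one step *)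

Section ExactSolution.
Variables (R : realType) (d : nat) (eps0 T : R) (adm : R -> R -> nat -> Prop).
Hypothesis hadm : forall eps dt n, adm eps dt n -> 0 < eps <= eps0 /\ 0 < dt.
Hypothesis adm_le : forall eps dt n, adm eps dt n -> n.+1%:R * dt <= T.
Local Notation V := 'rV[R]_d.+1.
Variables (B : R -> V -> R) (K : set (V -> R)) (f : R -> R -> R -> V -> R).
Hypotheses (Qb : op_bounded K (collision B)) (Ql : op_lipschitz K (collision B)).
Hypothesis sol : forall eps dt n,
  adm eps dt n -> boltzmann_solution B eps T (f eps).
Hypothesis fK : forall eps dt n t x,
  adm eps dt n -> 0 <= t <= T -> K (f eps t x).
Hypothesis fx : forall k, exists C, forall eps dt n t x,
  adm eps dt n -> 0 <= t <= T ->
  decay_le k C (fun v => derive1 (fun y => f eps t y v) x).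

Definition at_step : kinetic_family R d := fun eps dt n => f eps (n%:R * dt).

Lemma step_time eps dt n : adm eps dt n -> 0 <= n%:R * dt <= T.
Proof.
move=> ad; have [_ t0] := hadm ad; rewrite mulr_ge0 ?(ltW t0)//=.
by rewrite (le_trans _ (adm_le ad))// ler_pM2r// ler_nat.
Qed.

Lemma at_step_in_class : in_class adm K at_step.
Proof. by move=> eps dt n x ad; apply: fK (ad) (step_time ad). Qed.

Lemma at_step_x_lipschitz : x_lipschitz adm at_step.
Proof.
move=> k; have [C hC] := fx k; exists C => eps dt n x y ad v.
have tT := step_time ad.
have w0 : 0 < (1 + enorm v) ^+ k := lt_le_trans ltr01 (weight_ge1 v k).
(* For each fixed [v] the function of [x] is Lipschitz with constant [C] divided by the weight. *)
rewrite mulrC -ler_pdivlMr// mulrAC.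
apply: (@lipschitz_of_derive_bound _ (fun y => f eps (n%:R * dt) y v)) => z.
  have [du _] := sol ad z v tT.
  have := @is_derive_affine _ (fun p => f eps p.1 p.2 v) (n%:R * dt) 0 0 1 z.
  rewrite mulr0 mulr1 addr0 add0r => /(_ du) dz.
  rewrite (_ : (fun y => _) =
    fun r => f eps (n%:R * dt + r * 0, 0 + r * 1).1
                   (n%:R * dt + r * 0, 0 + r * 1).2 v).
    exact: (@ex_derive _ _ _ _ _ _ _ dz).
  by apply/funext => r; rewrite /= mulr0 mulr1 addr0 add0r.
by rewrite ler_pdivlMr// [leLHS]mulrC; exact: (hC _ _ _ _ z ad tT v).
Qed.

(* By the mean value theorem the increment along a characteristic is
   [dt / eps] times a value of the collision term within O(dt / eps) of its
   value at the foot.  The distance of the two base points grows with [v], and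
   this factor is absorbed by one extra power of the weight. *)
Lemma exact_order2 : decayO adm 2 (fun eps dt n x v =>
  f eps (n.+1%:R * dt) x v - (advect 1 at_step eps dt n x v + dt / eps *
    advect 1 (fun eps dt n x => collision B (at_step eps dt n x)) eps dt n x v)).
Proof.
move=> k; have [l [L hL]] := Ql k.+1.
(* Here [l.+1] pays for the factor [1 + enorm w] in the distance between base points, as [k.+1] does
   for [1 + enorm v]. *)
have [C1 hC1] := Qb l; have [C2 hC2] := at_step_x_lipschitz l.+1.
(* [C1] accounts for the evolution in time, [eps0] times the absolute value of [C2] for the
   displacement in [x]. *)
pose M := C1 + `|C2| * eps0; exists (L * M) => eps dt n x ad v.
have [/andP[e0 ee0] t0] := hadm ad; have [tn0 tnT] := andP (step_time ad).
set t := n%:R * dt in tn0 tnT.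
have tT : t + dt <= T.
  by rewrite (le_trans _ (adm_le ad))// /t -natr1 mulrDl mul1r.
have wgt (w : V) : 1 <= 1 + enorm w by rewrite lerDl enorm_ge0.
have wgt0 (w : V) : 0 < 1 + enorm w := lt_le_trans ltr01 (wgt w).
have [s /andP[s0 st] fE] :=
  boltzmann_characteristic x v (sol ad) tn0 (ltW t0) tT.
set ys := x - (dt - s) * v 0 0 in fE; set y0 := x - dt * v 0 0 in fE.
have tsT : 0 <= t + s <= T.
  by rewrite addr_ge0//= (le_trans _ tT)// lerD2l.
have C1_ge0 : 0 <= C1 := decay_le_ge0 (hC1 _ (fK ys ad tsT)).
(* The collision term at [v] sees all velocities [w], so whole profiles are compared: each [w] goes
   back along its own characteristic, which misses [y0] by [s * (v 0 0 - w 0 0)]. The factor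
   [1 + enorm v] is constant in [w]. *)
have base : decay_le l (M * (1 + enorm v) * (dt / eps))
    (fun w => f eps (t + s) ys w - f eps t y0 w).
  move=> w; have [r /andP[r0 rs] wE] :=
    boltzmann_characteristic ys w (sol ad) tn0 s0 (andP tsT).2.
  have -> : f eps (t + s) ys w - f eps t y0 w =
      s / eps * collision B (f eps (t + r) (ys - (s - r) * w 0 0)) w +
      (f eps t (ys - s * w 0 0) w - f eps t y0 w).
    by rewrite -mulrA -wE; ring.
  have trT : 0 <= t + r <= T.
    by rewrite addr_ge0//= (le_trans _ (andP tsT).2)// lerD2l.
  have := hC1 _ (fK (ys - (s - r) * w 0 0) ad trT) w.
  set q := collision B _ w => qle.
  have := hC2 _ _ _ (ys - s * w 0 0) y0 ad w; rewrite /at_step -/t.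
  set p := f eps t _ w - _ => ple.
  have sdt : s / eps <= dt / eps by rewrite ler_pM2r ?invr_gt0.
  have se0 : 0 <= s / eps by rewrite divr_ge0// ltW.
  have dte : dt <= eps0 * (dt / eps).
    by rewrite mulrCA ler_peMr ?(ltW t0)// ler_pdivlMr// mul1r.
  have dist : `|ys - s * w 0 0 - y0| <= dt * ((1 + enorm v) * (1 + enorm w)).
    rewrite (_ : ys - _ - y0 = s * (v 0 0 - w 0 0)); last first.
      by rewrite /ys /y0; ring.
    rewrite normrM (ger0_norm s0) ler_pM//.
    rewrite (le_trans (ler_normB _ _))//.
    rewrite (le_trans (lerD (ler_coord_enorm v 0) (ler_coord_enorm w 0)))//.
    have -> : (1 + enorm v) * (1 + enorm w) =
      enorm v + enorm w + (1 + enorm v * enorm w) by ring.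
    by rewrite lerDl addr_ge0// mulr_ge0 ?enorm_ge0.
  have qle' : (1 + enorm w) ^+ l * `|s / eps * q| <=
      C1 * (1 + enorm v) * (dt / eps).
    rewrite normrM (ger0_norm se0) mulrCA mulrC.
    apply: ler_pM => //; first by rewrite mulr_ge0 ?weight_ge0.
    by rewrite (le_trans qle)// ler_peMr.
  have ple' : (1 + enorm w) ^+ l * `|p| <=
      `|C2| * eps0 * (1 + enorm v) * (dt / eps).
    rewrite -(ler_pM2l (wgt0 w)) mulrA -exprS (le_trans ple)//.
    rewrite (le_trans (ler_wpM2r (normr_ge0 _) (ler_norm C2)))//.
    have -> : (1 + enorm w) * (`|C2| * eps0 * (1 + enorm v) * (dt / eps)) =
      `|C2| * (eps0 * (dt / eps) * ((1 + enorm v) * (1 + enorm w))) by ring.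
    rewrite ler_wpM2l// (le_trans dist)// ler_wpM2r//.
    by rewrite mulr_ge0// ltW.
  rewrite /M 2!mulrDl (le_trans _ (lerD qle' ple'))// -mulrDr.
  by rewrite ler_wpM2l ?weight_ge0// ler_normD.
have t0T : 0 <= t <= T by rewrite tn0.
have dQ := hL _ _ _ (fK y0 ad t0T) (fK ys ad tsT) base v.
rewrite exprS -mulrA in dQ.
have fE1 : f eps (n.+1%:R * dt) x v = f eps t y0 v +
    dt / eps * collision B (f eps (t + s) ys) v.
  have -> : n.+1%:R * dt = t + dt by rewrite /t -natr1 mulrDl mul1r.
  by rewrite -mulrA -fE; ring.
have err (a b c : R) : a + dt / eps * b - (a + dt / eps * c) =
  dt / eps * (b - c) by ring.
have yE : x - 1 * v 0 0 * dt = y0 by rewrite /y0; ring.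
rewrite fE1 /advect /transport /at_step/= -/t yE err.
set D := `|collision B (f eps (t + s) ys) v - _| in dQ *.
have r0 : 0 <= dt / eps by rewrite divr_ge0 ?ltW.
rewrite normrM (ger0_norm r0) -/D.
have -> : (1 + enorm v) ^+ k * (dt / eps * D) =
  dt / eps * ((1 + enorm v) ^+ k * D) by ring.
have -> : L * M * (dt / eps) ^+ 2 = dt / eps * (L * M * (dt / eps)) by ring.
rewrite ler_wpM2l// -(ler_pM2l (wgt0 v)) (le_trans dQ)//.
by rewrite le_eqVlt; apply/orP; left; apply/eqP; ring.
Qed.

End ExactSolution.

(** * Comparison of the last stage with the exact solution *)

Theorem theorem4p6 (R : realType) (d m : nat)
  (B : R -> 'rV[R]_d.+1 -> R) (beta : ('rV[R]_d.+1 -> R) -> R)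
  (A At : 'M[R]_(1 + m)) (b bt : 'rV[R]_(1 + m))
  (K : set ('rV[R]_d.+1 -> R))
  (eps0 T : R) (regime : R -> R -> Prop)
  (f : R -> R -> R -> 'rV[R]_d.+1 -> R)
  (F : R -> R -> nat -> 'I_(1 + m) -> R -> 'rV[R]_d.+1 -> R)
  (fnum : R -> R -> nat -> R -> 'rV[R]_d.+1 -> R)
  (g h : 'I_(1 + m) -> R)
  (* the tableaux *)
  (hA : explicit_tableau A) (hAt : implicit_tableau At)
  (hCK : type_CK_ARS A At bt) (hGSA : GSA A At b bt)
  (hc : forall i, abscissa A i = abscissa At i)
  (hg : g_recursion At g) (hh : h_recursion A At h)
  (* smoothness of Q and Q_P (hence of G_P) on the class K *)
  (hbeta : forall w, K w -> 0 < beta w)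
  (hQb : op_bounded K (collision B)) (hQl : op_lipschitz K (collision B))
  (hPb : op_bounded K (QP beta)) (hPl : op_lipschitz K (QP beta))
  (* the pairs (eps, dt) over which the O is taken: [eps = e, 0 < dt <= r] for a
     fixed eps, or e.g. [0 < dt <= r * eps, eps <= 1] uniformly in eps *)
  (hreg : forall eps dt, regime eps dt -> 0 < eps <= eps0 /\ 0 < dt)
  (* the exact solution f eps, and its smoothness *)
  (hf : forall eps dt, regime eps dt -> boltzmann_solution B eps T (f eps))
  (hfK : forall eps dt (t x : R), regime eps dt -> 0 <= t <= T -> K (f eps t x))
  (hfx : forall k, exists C, forall eps dt (t x : R),
     regime eps dt -> 0 <= t <= T ->
     decay_le k C (fun v => derive1 (fun y : R => f eps t y v) x))
  (* one step of the scheme, from f^n = f(n dt) *)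
  (hF : forall eps dt n, regime eps dt -> n.+1%:R * dt <= T ->
     shu_osher_step B beta A At eps dt
       (f eps (n%:R * dt)) (F eps dt n) (fnum eps dt n.+1))
  (hFK : forall eps dt n i x, regime eps dt -> n.+1%:R * dt <= T ->
     K (F eps dt n i x)) :
  g (@ord_max m) = 1 -> h (@ord_max m) = 1 ->
  exists C : R, forall eps dt n x v,
    regime eps dt -> n.+1%:R * dt <= T ->
    `|fnum eps dt n.+1 x v - f eps (n.+1%:R * dt) x v|
      <= C * (dt ^+ 2 / eps ^+ 2).
Proof.
move=> g1 h1.
pose adm eps dt (n : nat) := regime eps dt /\ n.+1%:R * dt <= T.
have hadm eps dt n : adm eps dt n -> 0 < eps <= eps0 /\ 0 < dt.
  by move=> [/hreg].
have adm_le eps dt n : adm eps dt n -> n.+1%:R * dt <= T by case.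
have sol eps dt n : adm eps dt n -> boltzmann_solution B eps T (f eps).
  by move=> [/hf].
have fK eps dt n t x : adm eps dt n -> 0 <= t <= T -> K (f eps t x).
  by move=> [re _]; exact: hfK re.
have fx k : exists C, forall eps dt n t x, adm eps dt n -> 0 <= t <= T ->
    decay_le k C (fun v => derive1 (fun y => f eps t y v) x).
  by have [C hC] := hfx k; exists C => eps dt n t x [re _]; exact: hC re.
have Ku := at_step_in_class hadm adm_le fK.
have ul := at_step_x_lipschitz hadm adm_le sol fx.
have exact2 := exact_order2 hadm adm_le hQb hQl sol fK fx.
pose G p : kinetic_family R d := fun eps dt n => F eps dt n p.
have KG p : in_class adm K (G p) by move=> eps dt n x [re le]; exact: hFK.
have Gstep eps dt n : adm eps dt n -> shu_osher_step B beta A At eps dt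
    (at_step f eps dt n) (fun p => G p eps dt n) (G (@ord_max m) eps dt n).
  by move=> [re le]; have [? ? _] := hF _ _ _ re le; split.
have num2 := stage_order2 hadm hQb hPb hQl hPl hg hh Ku KG ul Gstep (@ord_max m).
(* The last stage must be shifted by exactly one full step for its foot to be that of the exact
   solution. *)
have c1 : abscissa A (@ord_max m) = 1.
  by rewrite hc (g_recursion_abscissa hAt hCK hg).
rewrite g1 h1 c1 in num2.
(* Weight [0] gives the plain pointwise bound. *)
have [C hC] := decayOB num2 exact2 0; exists C => eps dt n x v re le.
have := hC eps dt n x (conj re le) v.
have [_ _ ->] := hF _ _ _ re le.
rewrite expr0 mul1r -expr_div_n; congr (`|_| <= _).
(* Unfolding [GP] merges [QP + GP] into [collision], so the two expansions cancel. *)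
rewrite /G /advect /transport /GP; ring.
Qed.
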